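(* Let $\succsim_1$ and $\succsim_2$ be two niveloidal preferences on $\mathcal F$, with corresponding utility indices $u_i$ and grounded subsets $C_i^*$ and $B_i^*$ of $\mathscr{C}$ ($i=1,2$). Then the following conditions are equivalent: (i) $\succsim_1$ is more ambiguity averse than $\succsim_2$; (ii) $u_1\approx u_2$ and $C_1^*\subseteq C_2^*$ (provided $u_1=u_2$); (iii) $u_1\approx u_2$ and $B_1^*\supseteq B_2^*$ (provided $u_1=u_2$). Here $u_1\approx u_2$ means that $u_1$ and $u_2$ are positive affine transformations of each other, and ''provided $u_1=u_2$'' means that the inclusion is asserted for the sets computed with the same normalization $u_1=u_2$ of the utility index.
   Context: Setting. $S$ is a nonempty set, $\Sigma$ an algebra of subsets of $S$, $X$ a nonempty convex subset of a real vector space. $\mathcal{F}$ is the set of simple acts: $\Sigma$-measurable maps $f:S\to X$ with finitely many values. Each $x\in X$ is identified with the constant act equal to $x$. Mixtures are defined statewise. For $u:X\to\mathbb{R}$ and $f\in\mathcal F$, $u(f)$ is the function $s\mapsto u(f(s))$. $\Delta$ is the set of finitely additive probabilities on $\Sigma$, with the weak* topology $\sigma(\Delta,B_0(\Sigma))$, where $B_0(\Sigma)$ is the space of real-valued $\Sigma$-measurable functions on $S$ with finitely many values. For a binary relation $\succsim$ on $\mathcal F$, $\sim$ and $\succ$ are its symmetric and asymmetric parts. $\succsim$ is a niveloidal preference if it satisfies: A1 (Weak Order): $\succsim$ is nontrivial ($f\succ g$ for some $f,g\in\mathcal F$), complete and transitive. A2 (Monotonicity): if $f(s)\succsim g(s)$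 for all $s\in S$, then $f\succsim g$. A3 (Archimedean): if $f\succ g\succ h$ there are $\alpha,\beta\in(0,1)$ with $\alpha f+(1-\alpha)h\succ g\succ\beta f+(1-\beta)h$. A4 (Weak C-Independence): for all $f,g\in\mathcal F$, $x,y\in X$, $\alpha\in(0,1)$, $\alpha f+(1-\alpha)x\succsim\alpha g+(1-\alpha)x$ implies $\alpha f+(1-\alpha)y\succsim\alpha g+(1-\alpha)y$. $\mathscr{C}$ is the set of all lower semicontinuous convex functions $c:\Delta\to(-\infty,\infty]$. $C\subseteq\mathscr{C}$ is grounded if $\sup_{c\in C}\min_{p\in\Delta}c(p)=0$. Representation. For every niveloidal preference $\succsim$ there are a nonconstant affine $u:X\to\mathbb R$ (the utility index, unique up to positive affine transformations) and a grounded $C\subseteq\mathscr C$ such that $f\succsim g$ iff $\max_{c\in C}\min_{p\in\Delta}(\int u(f)dp+c(p))\ge\max_{c\in C}\min_{p\in\Delta}(\int u(g)dp+c(p))$; and, for the same $u$, a grounded $B\subseteq\mathscr C$ such that $f\succsim g$ iff $\min_{b\in B}\max_{q\in\Delta}(\int u(f)dq-b(q))\ge\min_{b\in B}\max_{q\in\Delta}(\int u(g)dq-b(q))$. Given $u$, the largest such sets are $$C^*=\{c\in\mathscr C\mid \min_{p\in\Delta}(\textstyle\int u(f)dp+c(p))\le u(x_f)\ \forall f\in\mathcal F\},\quad B^*=\{b\in\mathscr C\mid \max_{q\in\Delta}(\int u(f)dq-b(q))\ge u(x_f)\ \forall f\in\mathcal F\},$$ where $x_f\in X$ is a certainty equivalent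 of $f$, i.e. $x_f\sim f$. $C_i^*,B_i^*$ are these sets for $\succsim_i$ and $u_i$. $\succsim_1$ is more ambiguity averse than $\succsim_2$ if, for all $f\in\mathcal F$ and $x\in X$, $x\succsim_2 f$ implies $x\succsim_1 f$. *)

(* Defs.v *)
From HB Require Import structures.
From mathcomp Require Import all_boot all_order all_algebra.
From mathcomp Require Import interval_inference.
From mathcomp Require Import all_classical all_reals all_analysis.

Set Implicit Arguments.
Unset Strict Implicit.
Unset Printing Implicit Defensive.

Import Order.TTheory GRing.Theory Num.Theory.
Import numFieldNormedType.Exports.

Local Open Scope classical_set_scope.
Local Open Scope ring_scope.

(* The pair (S, Sigma) is an [algebraOfSetsType]: [measurable] is Sigma, and
   the structure includes a point of S, so S is nonempty. *)

Section simple.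
Context d (S : algebraOfSetsType d).

(* For a map with finitely many values, measurability with respect to an
   algebra of sets amounts to measurability of the fibers. *)
Definition simple (T : Type) (f : S -> T) : Prop :=
  finite_set (range f) /\ forall y, measurable (f @^-1` [set y]).

Definition simple_act (T : Type) (X : set T) (f : S -> T) : Prop :=
  simple f /\ range f `<=` X.

End simple.

Section finitely_additive_probabilities.
Context d (S : algebraOfSetsType d) (R : realType).

(* A [content] is a function on all subsets of S, about which the library only
   requires nonnegativity outside Sigma.  The value there is set to 0, so that
   two elements of [fprob] are equal as soon as they agree on Sigma. *)
Record fprob := FProb {
  fprob_content :> {content set S -> \bar R} ;
  fprob_setT : fprob_content setT = 1%E ;
  fprob_out : forall A, ~ measurable A -> fprob_content A = 0%E }.

HB.instance Definition _ := gen_eqMixin fprob.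
HB.instance Definition _ := gen_choiceMixin fprob.

Definition fint (p : fprob) (phi : S -> R) : R := fine (sintegral p phi).

Definition B0 : Type := {phi : S -> R | simple phi}.
HB.instance Definition _ := gen_eqMixin B0.
HB.instance Definition _ := gen_choiceMixin B0.

Definition fprob_eval (p : fprob) : prod_topology (fun _ : B0 => R) :=
  fun phi => fint p (sval phi).

(* The topology sigma(Delta, B0): pointwise convergence on B0. *)
HB.instance Definition _ :=
  Topological.copy fprob (initial_topology fprob_eval).

Section mixture.
Variables (t : {i01 R}) (p q : fprob).

Definition fmix_fun (A : set S) : \bar R :=
  ((t%:num)%:E * p A + (1 - t%:num)%:E * q A)%E.

Let t0 : (0 <= (t%:num)%:E :> \bar R)%E.
Proof. by rewrite lee_fin. Qed.

Let t1 : (0 <= (1 - t%:num)%:E :> \bar R)%E.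
Proof. by rewrite lee_fin subr_ge0. Qed.

Let fmix_ge0 A : (0 <= fmix_fun A)%E.
Proof. by rewrite adde_ge0// mule_ge0. Qed.

Let fmix_semi_additive : measure_function.semi_additive fmix_fun.
Proof.
move=> F n mF tF mU; rewrite /fmix_fun !measure_semi_additive//.
by rewrite !ge0_sume_distrr// big_split.
Qed.

HB.instance Definition _ :=
  isContent.Build d S R fmix_fun fmix_ge0 fmix_semi_additive.

Let fmix_setT : fmix_fun setT = 1%E.
Proof.
by rewrite /fmix_fun !fprob_setT !mule1 -EFinD; congr EFin; rewrite addrC subrK.
Qed.

Let fmix_out A : ~ measurable A -> fmix_fun A = 0%E.
Proof. by move=> mA; rewrite /fmix_fun !fprob_out// !mule0 adde0. Qed.

Definition fmix : fprob := FProb fmix_setT fmix_out.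

End mixture.

(* At t = 0 and t = 1 the convexity inequality uses the convention 0 * +oo = 0. *)
Definition costs : set (fprob -> \bar R) := [set c |
  [/\ forall p, c p != -oo%E,
      lower_semicontinuous c &
      forall (t : {i01 R}) (p q : fprob),
        (c (fmix t p q) <= (t%:num)%:E * c p + (1 - t%:num)%:E * c q)%E]].

End finitely_additive_probabilities.

(* [is_min A m]: the minimum of A is attained and equal to m. *)
Definition is_min (R : realType) (A : set (\bar R)) (m : \bar R) : Prop :=
  A m /\ lbound A m.

Definition is_max (R : realType) (A : set (\bar R)) (m : \bar R) : Prop :=
  A m /\ ubound A m.

Section preferences.
Context d (S : algebraOfSetsType d) (R : realType) (V : lmodType R).
Variable X : set V.

Local Notation Delta := (fprob S R).
Local Notation F := (@simple_act d S V X).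

Definition act_mix (t : R) (f g : S -> V) : S -> V :=
  fun s => t *: f s + (1 - t) *: g s.

(* A preference is a relation on all maps S -> V; only its restriction to the
   simple acts with values in X is ever used. *)
Implicit Types (pref : (S -> V) -> (S -> V) -> Prop) (u : V -> R).

Definition strict pref f g := pref f g /\ ~ pref g f.
Definition indiff pref f g := pref f g /\ pref g f.

Record niveloidal pref : Prop := Niveloidal {
  niv_nontrivial : exists f g, [/\ F f, F g & strict pref f g] ;
  niv_complete : forall f g, F f -> F g -> pref f g \/ pref g f ;
  niv_trans : forall f g h, F f -> F g -> F h ->
    pref f g -> pref g h -> pref f h ;
  niv_monotone : forall f g, F f -> F g ->
    (forall s, pref (cst (f s)) (cst (g s))) -> pref f g ;
  niv_archimedean : forall f g h, F f -> F g -> F h ->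
    strict pref f g -> strict pref g h ->
    exists a b : R, [/\ 0 < a < 1, 0 < b < 1,
      strict pref (act_mix a f h) g & strict pref g (act_mix b f h)] ;
  niv_weak_c_indep : forall f g x y (a : R), F f -> F g -> X x -> X y ->
    0 < a < 1 ->
    pref (act_mix a f (cst x)) (act_mix a g (cst x)) ->
    pref (act_mix a f (cst y)) (act_mix a g (cst y)) }.

(* Delta being compact, every c in [costs] attains its minimum, so no c in C is
   left out of the supremum. *)
Definition grounded (C : set (Delta -> \bar R)) : Prop :=
  C `<=` @costs d S R /\
  ereal_sup [set m | exists2 c, C c & is_min (range c) m] = 0%E.

Definition plus_values u (f : S -> V) (c : Delta -> \bar R) : set (\bar R) :=
  range (fun p : Delta => ((fint p (u \o f))%:E + c p)%E).

Definition minus_values u (f : S -> V) (b : Delta -> \bar R) : set (\bar R) :=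
  range (fun q : Delta => ((fint q (u \o f))%:E - b q)%E).

Definition is_maxmin u (C : set (Delta -> \bar R)) (f : S -> V) (v : \bar R) :=
  is_max [set m | exists2 c, C c & is_min (plus_values u f c) m] v.

Definition is_minmax u (B : set (Delta -> \bar R)) (f : S -> V) (v : \bar R) :=
  is_min [set m | exists2 b, B b & is_max (minus_values u f b) m] v.

Definition represents pref (is_value : (S -> V) -> \bar R -> Prop) : Prop :=
  exists W : (S -> V) -> \bar R,
    (forall f, F f -> is_value f (W f)) /\
    (forall f g, F f -> F g -> (pref f g <-> (W g <= W f)%E)).

Definition affine_on u : Prop := forall x y (t : R), X x -> X y ->
  0 <= t <= 1 -> u (t *: x + (1 - t) *: y) = t * u x + (1 - t) * u y.

Record utility_index pref u : Prop := UtilityIndex {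
  util_affine : affine_on u ;
  util_nonconstant : exists x y, [/\ X x, X y & u x != u y] ;
  util_maxmin : exists C, grounded C /\ represents pref (is_maxmin u C) ;
  util_minmax : exists B, grounded B /\ represents pref (is_minmax u B) }.

Definition Cstar pref u : set (Delta -> \bar R) := [set c | costs c /\
  forall f x, F f -> X x -> indiff pref (cst x) f ->
    exists m, is_min (plus_values u f c) m /\ (m <= (u x)%:E)%E].

Definition Bstar pref u : set (Delta -> \bar R) := [set b | costs b /\
  forall f x, F f -> X x -> indiff pref (cst x) f ->
    exists m, is_max (minus_values u f b) m /\ ((u x)%:E <= m)%E].

Definition more_ambiguity_averse pref1 pref2 : Prop :=
  forall f x, F f -> X x -> pref2 (cst x) f -> pref1 (cst x) f.

Definition cardinally_equivalent u1 u2 : Prop :=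
  exists a b : R, 0 < a /\ forall x, X x -> u1 x = a * u2 x + b.

(* A utility function [u] that is at once a normalization of u1 and of u2. *)
Definition common_normalization u1 u2 u : Prop :=
  cardinally_equivalent u u1 /\ cardinally_equivalent u u2.

End preferences.

(* Main.v *)
(**
Both preferences have certainty equivalents, because X is convex and the value
of f lies between the smallest and the largest utility reached by f.
Comparative ambiguity aversion says that u(x_f) is smaller for the first
preference than for the second one, which gives at once the inclusions between
the sets C* and B*.  Conversely, some c in C*_1 attains
min_p (int u(f) dp + c(p)) = u(x_f) for the first preference: take c optimal at
f in a maxmin representation.  If c is in C*_2, this minimum is at most the
utility of the second certainty equivalent of f.  The dual argument handles B*.

That an optimal c belongs to C* requires the minima to be attained at all the
other acts, hence the compactness of the set of finitely additive
probabilities: the limit of an ultrafilter U is A |-> lim_U p(A).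
*)

Require Import Defs.
From HB Require Import structures.
From mathcomp Require Import all_boot all_order all_algebra.
From mathcomp Require Import interval_inference.
From mathcomp Require Import all_classical all_reals all_analysis.
From mathcomp Require Import finmap ring lra.

Set Implicit Arguments.
Unset Strict Implicit.
Unset Printing Implicit Defensive.

Import Order.TTheory GRing.Theory Num.Theory.
Import numFieldNormedType.Exports.

Local Open Scope classical_set_scope.
Local Open Scope ring_scope.

(** * Semicontinuity and limits along filters *)

Lemma lower_semicontinuous_min (T : topologicalType) (R : realType)
    (f : T -> \bar R) :
  compact [set: T] -> [set: T] !=set0 -> lower_semicontinuous f ->
  (forall x, f x != -oo%E) -> exists x, forall y, (f x <= f y)%E.
Proof.
move=> cT [x0 _] lf fNy.
(* A cluster point of the sublevel sets is a minimizer. *)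
have PF : ProperFilter (filter_from setT (fun y => [set x | (f x <= f y)%E])).
  apply: filter_from_proper; last by move=> y _; exists y => /=.
  apply: filter_from_filter; first by exists x0.
  move=> y z _ _; case: (leP (f y) (f z)) => yz.
    by exists y => // x /= xy; split=> //; exact: le_trans yz.
  by exists z => // x /= xz; split=> //; apply: le_trans (ltW yz).
have [|p [_ clp]] := cT _ PF; first by exists x0.
exists p => y; rewrite leNgt; apply/negP => yp.
(* Semicontinuity is tested at real levels, so [f y] must be finite: it is not [-oo], and it lies
   strictly below [f p]. *)
have fyE : (fine (f y))%:E = f y.
  by rewrite fineK// fin_numE fNy -ltey (lt_le_trans yp)// leey.
have [|V Vp lV] := lf p (fine (f y)); first by rewrite fyE.
have [|x /= [xy Vx]] := clp [set x | (f x <= f y)%E] V _ Vp.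
  by exists y.
by move: (lV _ Vx); rewrite fyE ltNge xy.
Qed.

Lemma lower_semicontinuousD (T : topologicalType) (R : realType)
    (h : T -> R) (c : T -> \bar R) :
  continuous h -> lower_semicontinuous c ->
  lower_semicontinuous (fun x => (h x)%:E + c x)%E.
Proof.
move=> ch lc x a axc.
(* The gap between [a - h x] and the level [b] absorbs the variation of [h] near [x]. *)
have [b ab bc] : exists2 b : R, a - h x < b & (b%:E < c x)%E.
  move: axc; case: (c x) => [r| |].
  - rewrite -EFinD lte_fin => ar; have /midf_lt[] : a - h x < r by lra.
    by exists ((a - h x + r) / 2%:R) => //; rewrite ?lte_fin.
  - by exists (a - h x + 1); rewrite ?ltry// ltrDl.
  - by rewrite addeNy ltNge leNye.
have [V Vx lV] := lc x b bc.
exists (V `&` [set y | a - b < h y]).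
  apply: filterI => //.
  by apply: (cvgr_gt (h x) (ch x)); rewrite ltrBlDr -ltrBlDl.
move=> y [/lV by_ /= aby].
rewrite -(subrK b a) EFinD; by apply: lteD => //; rewrite lte_fin.
Qed.

Lemma cvg_initial_topology (T : choiceType) (U : topologicalType) (f : T -> U)
    (F : set_system T) (x : T) :
  Filter F -> f @ F --> f x -> F --> (x : initial_topology f).
Proof.
move=> FF Ffx A; rewrite nbhsE => -[B [[C oC <-] /= Cx] BA].
by apply: (filterS BA); apply: Ffx; exact: open_nbhs_nbhs.
Qed.

(** A cluster point is already a limit: were the preimage of a neighbourhood not in [F], its
    complement would be, and the neighbourhood would meet its own complement. *)
Lemma ultra_cvg_compact (T : Type) (U : topologicalType) (F : set_system T)
    (K : set U) (f : T -> U) : UltraFilter F -> compact K ->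
  (forall x, K (f x)) -> exists2 l, K l & f @ F --> l.
Proof.
move=> UF cK Kf.
have FK : (f @ F) K by apply: nearW => x; exact: Kf.
have [l [Kl cl]] := cK (f @ F) _ FK.
exists l => // V lV; have [//|FV] := in_ultra_setVsetC (f @^-1` V) UF.
by have [x []] := cl (~` V) V FV lV.
Qed.

(** * Compactness of the set of finitely additive probabilities *)

Section compactness.
Context d (S : algebraOfSetsType d) (R : realType).
Local Notation Delta := (fprob S R).

Lemma fprob_le1 (p : Delta) A : (p A <= 1)%E.
Proof.
have [mA|mA] := pselect (measurable A); last by rewrite fprob_out.
rewrite -(fprob_setT p) le_measure//; exact/mem_set.
Qed.

Lemma fprob_fin_num (p : Delta) A : p A \is a fin_num.
Proof.
by rewrite ge0_fin_numE ?(le_lt_trans (fprob_le1 p A)) ?ltry// measure_ge0.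
Qed.

Lemma sintegral_range (p : Delta) (phi : S -> R) :
  (sintegral p phi = \sum_(y \in range phi) (y%:E * p (phi @^-1` [set y])))%E.
Proof.
rewrite (fsbig_widen (range phi) setT)//= => y [_ Nphiy] /=.
by rewrite preimage10// measure0 mule0.
Qed.

Lemma fintE (p : Delta) (phi : S -> R) : simple phi ->
  fint p phi = \sum_(y <- fset_set (range phi))
    y * fine (p (phi @^-1` [set y])).
Proof.
move=> [fphi _]; rewrite /fint sintegral_range fsbig_finite//= -sum_fine//.
  apply: eq_bigr => y _.
  by rewrite -[in LHS](fineK (fprob_fin_num p _)).
by move=> y _; rewrite fin_numM// fprob_fin_num.
Qed.

Lemma fint_cst (p : Delta) (r : R) : fint p (cst r) = r.
Proof.
have rr : range (cst r : S -> R) = [set r].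
  by apply/seteqP; split => [_ [s _ <-]//|_ ->]; exists point.
rewrite /fint sintegral_range rr fsbig_set1 preimage_cst mem_set//=.
by rewrite fprob_setT mule1.
Qed.

Lemma fint_continuous (phi : S -> R) : simple phi ->
  continuous (fun p : Delta => fint p phi).
Proof.
move=> sphi p.
have := @proj_continuous _ (fun _ : B0 S R => R) (exist _ phi sphi)
  (fprob_eval p).
exact: cvg_comp (@initial_continuous _ _ (@fprob_eval d S R) p).
Qed.

Lemma fprob_cvg (F : set_system Delta) (p : Delta) : Filter F ->
  (forall phi, simple phi -> fint q phi @[q --> F] --> fint p phi) -> F --> p.
Proof.
move=> FF Fp; apply: cvg_initial_topology; apply/cvg_sup => -[phi sphi].
by apply: cvg_initial_topology; exact: Fp.
Qed.

Section ultralimit.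
Variables (U : set_system Delta) (UU : UltraFilter U).

Let mu (A : set S) : \bar R := (lim (fine ((p : Delta) A) @[p --> U]))%:E.

(** [lim] is a genuine limit because the numbers [p A] lie in a compact interval and [U] is an
    ultrafilter. *)
Let cvg_mu A : fine ((p : Delta) A) @[p --> U] -->
  lim (fine ((p : Delta) A) @[p --> U]).
Proof.
have cI : compact `[0, 1 : R] by exact: segment_compact.
have [|l _ Ul] := ultra_cvg_compact UU (f := fun p : Delta => fine (p A)) cI.
  move=> p /=; rewrite in_itv/= fine_ge0//=.
  by rewrite -lee_fin fineK ?fprob_fin_num// fprob_le1.
by apply/cvg_ex; exists l.
Qed.

Let mu_cvgE A l : fine ((p : Delta) A) @[p --> U] --> l -> mu A = l%:E.
Proof. by move=> Ul; congr EFin; exact: (cvg_lim (@Rhausdorff R)). Qed.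

Let mu_ge0 A : (0 <= mu A)%E.
Proof.
rewrite lee_fin; apply: limr_ge; first by apply/cvg_ex; eexists; exact: cvg_mu.
by apply: nearW => p; exact: fine_ge0.
Qed.

Let mu_semi_additive : measure_function.semi_additive mu.
Proof.
move=> F n mF tF mU; rewrite sumEFin; apply: mu_cvgE.
have -> : (fun p : Delta => fine (p (\big[setU/set0]_(i < n) F i))) =
    fun p : Delta => \sum_(i < n) fine (p (F i)).
  apply/funext => p; rewrite measure_semi_additive// sum_fine// => i _.
  exact: fprob_fin_num.
by apply: cvg_big => [|i _]; [exact: add_continuous|]; exact: cvg_mu.
Qed.

HB.instance Definition _ :=
  isContent.Build d S R mu mu_ge0 mu_semi_additive.

Let mu_setT : mu setT = 1%E.
Proof.
apply: mu_cvgE; apply: cvg_near_cst; apply: nearW => p.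
by rewrite fprob_setT.
Qed.

Let mu_out A : ~ measurable A -> mu A = 0%E.
Proof.
move=> mA; apply: mu_cvgE; apply: cvg_near_cst; apply: nearW => p.
by rewrite fprob_out.
Qed.

Lemma fprob_ultra_cvg : exists p : Delta, U --> p.
Proof.
exists (FProb mu_setT mu_out); apply: fprob_cvg => phi sphi.
rewrite fintE//; under eq_fun do rewrite fintE//.
apply: cvg_big => [|y _]; first exact: add_continuous.
by apply: cvgMl_tmp; exact: cvg_mu.
Qed.

End ultralimit.

Lemma fprob_compact : compact [set: Delta].
Proof.
rewrite compact_ultra => U UU _.
by have [p Up] := fprob_ultra_cvg UU; exists p.
Qed.

(* [eps] is 1 for the minima defining C* and -1 for the maxima defining B*. *)
Lemma fint_min (phi : S -> R) (c : Delta -> \bar R) (eps : R) :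
  [set: Delta] !=set0 -> simple phi -> costs c ->
  exists p, forall q,
    ((eps * fint p phi)%:E + c p <= (eps * fint q phi)%:E + c q)%E.
Proof.
move=> Delta0 sphi [cNy lc _].
apply: lower_semicontinuous_min => //; first exact: fprob_compact.
  apply: lower_semicontinuousD => // p.
  apply: cvgMl_tmp; first exact: nbhs_filter.
  exact: (@fint_continuous phi sphi).
by move=> p; rewrite adde_eq_ninfty negb_or cNy.
Qed.

End compactness.

(** * Attained minima and maxima *)

Section extrema.
Variable R : realType.
Implicit Types (A : set (\bar R)) (r : R) (m : \bar R).

(** Serves constant acts, whose integral does not depend on the probability and merely shifts the
    range of a cost. *)
Lemma is_min_add A r m :
  is_min [set (r%:E + y)%E | y in A] m <-> is_min A (m - r%:E)%E.
Proof.
split=> [[[y Ay <-] lb]|[Am lb]].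
  rewrite addeAC subee// add0e; split=> // z Az.
  by rewrite -(@leeD2lE _ r%:E)//; apply: lb; exists z.
split; first by exists (m - r%:E)%E => //; rewrite addeC subeK.
by move=> _ [y Ay <-]; rewrite addeC -leeBlDr//; exact: lb.
Qed.

Lemma EFin_subKe r m : (r%:E - (r%:E - m) = m)%E.
Proof. by rewrite oppeB ?fin_num_adde_defr// addeA subee// add0e. Qed.

(** Reflection turns maxima of utility minus cost into minima of the cost, so that one notion of
    groundedness serves both representations. *)
Lemma is_max_sub A r m :
  is_max [set (r%:E - y)%E | y in A] m <-> is_min A (r%:E - m)%E.
Proof.
split=> [[[y Ay <-] ub]|[Am lb]].
  rewrite EFin_subKe; split=> // z Az.
  by rewrite -leeN2 -(@leeD2lE _ r%:E)//; apply: ub; exists z.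
split; first by exists (r%:E - m)%E => //; rewrite EFin_subKe.
move=> _ [y Ay <-]; rewrite -[leRHS](EFin_subKe r) leeD2lE// leeN2.
exact: lb.
Qed.

Lemma is_min_unique A m n : is_min A m -> is_min A n -> m = n.
Proof.
by move=> [Am lm] [An ln]; apply/eqP; rewrite eq_le lm//= ln.
Qed.

Lemma is_max_unique A m n : is_max A m -> is_max A n -> m = n.
Proof.
by move=> [Am um] [An un]; apply/eqP; rewrite eq_le un//= um.
Qed.

Lemma finite_range_max (T : Type) (t : T) (f : T -> R) :
  finite_set (range f) -> exists x, forall y, f y <= f x.
Proof.
move=> /finite_seqP[s fs].
have [r /= rs sr] : exists2 r, r \in s & forall y, y \in s -> y <= r.
  have : f t \in s by have : range f (f t) by []; rewrite fs.
  move: (f t) => c; elim: s c {fs} => // a s IH c _.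
  have [s0|[b bs]] : s = [::] \/ exists b, b \in s.
      by case: s {IH} => [|b s]; [left|right; exists b; rewrite mem_head].
    by exists a; rewrite s0 ?mem_head// => y; rewrite inE => /eqP ->.
  have [r rs sr] := IH b bs.
  have [ar|ra] := leP a r.
    exists r; first by rewrite inE rs orbT.
    by move=> y; rewrite inE => /predU1P[->|/sr].
  exists a; first exact: mem_head.
  by move=> y; rewrite inE => /predU1P[->//|/sr/le_trans]; apply; exact: ltW.
have /= : range f r by rewrite fs.
move=> [x _ fx]; exists x => y; rewrite fx; apply: sr.
by have : range f (f y) by []; rewrite fs.
Qed.

End extrema.

(** * Affine functions on a convex set *)

Section affine.
Context (R : realType) (V : lmodType R) (X : set V).
Hypothesis X_convex : convex_set X.

Lemma convex_set_mix x y (t : R) : X x -> X y -> 0 <= t <= 1 ->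
  X (t *: x + (1 - t) *: y).
Proof.
move=> Xx Xy /andP[t0 t1].
by have /set_mem := X_convex (Itv01 t0 t1) (mem_set Xx) (mem_set Xy).
Qed.

Lemma affine_ivt u x y (r : R) : affine_on X u -> X x -> X y ->
  u x <= r <= u y -> exists2 z, X z & u z = r.
Proof.
move=> ua Xx Xy /andP[xr ry]; have [xy|] := ltP (u x) (u y); last first.
  by move=> yx; exists x => //; apply/eqP; rewrite eq_le xr (le_trans ry).
have yx0 : 0 < u y - u x by rewrite subr_gt0.
(* The weight solving [u x + t * (u y - u x) = r]. *)
pose t := (r - u x) / (u y - u x).
have t01 : 0 <= t <= 1.
  by rewrite divr_ge0 ?subr_ge0//= ?(ltW xy)// ler_pdivrMr// mul1r lerB.
exists (t *: y + (1 - t) *: x); first exact: convex_set_mix.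
by rewrite ua// /t; field; rewrite gt_eqF.
Qed.

(* The points (u x, v x), (u y, v y), (u z, v z) of the plane are collinear. *)
Lemma affine_collinear u v x y z : affine_on X u -> affine_on X v ->
  (forall a b, X a -> X b -> u a = u b -> v a = v b) ->
  X x -> X y -> X z -> u x <= u y <= u z ->
  (u z - u x) * v y = (u y - u x) * v z + (u z - u y) * v x.
Proof.
move=> ua va uv Xx Xy Xz /andP[xy yz].
have [xz|] := ltP (u x) (u z); last first.
  move=> zx; have uyx : u y = u x by apply/eqP; rewrite eq_le xy (le_trans yz).
  have uzx : u z = u x by apply/eqP; rewrite eq_le zx (le_trans xy).
  by rewrite uyx uzx subrr !mul0r addr0.
have zx0 : 0 < u z - u x by rewrite subr_gt0.
pose t := (u y - u x) / (u z - u x).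
have t01 : 0 <= t <= 1.
  by rewrite divr_ge0 ?subr_ge0//= ?(ltW xz)// ler_pdivrMr// mul1r lerB.
(* The mixture need not be [y], but it has the same [u], hence the same [v]. *)
rewrite (uv y (t *: z + (1 - t) *: x)) ?va//.
- by rewrite /t; field; rewrite gt_eqF.
- exact: convex_set_mix.
- by rewrite ua// /t; field; rewrite gt_eqF.
Qed.

(** Weak order preservation makes [v] a function of [u]; collinearity with two reference points of
    distinct utility then makes that function affine. *)
Lemma affine_cardinally_equivalent u v : affine_on X u -> affine_on X v ->
  (exists x y, [/\ X x, X y & u x != u y]) ->
  (exists x y, [/\ X x, X y & v x != v y]) ->
  (forall x y, X x -> X y -> u x <= u y -> v x <= v y) ->
  cardinally_equivalent X v u.
Proof.
move=> ua va unc vnc uv.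
have uvE x y : X x -> X y -> u x = u y -> v x = v y.
  by move=> Xx Xy xy; apply/eqP; rewrite eq_le !uv ?xy.
have [x0 [x1 [Xx0 Xx1 u01]]] : exists x y, [/\ X x, X y & u x < u y].
  have [x [y [Xx Xy]]] := unc.
  by rewrite neq_lt => /orP[xy|yx]; [exists x, y|exists y, x].
have D0 : u x1 - u x0 != 0 by rewrite subr_eq0 gt_eqF.
pose a := (v x1 - v x0) / (u x1 - u x0); pose b := v x0 - a * u x0.
have vE x : X x -> v x = a * u x + b.
  move=> Xx; apply: (mulfI D0); rewrite /b /a.
  have -> : (u x1 - u x0) * ((v x1 - v x0) / (u x1 - u x0) * u x +
     (v x0 - (v x1 - v x0) / (u x1 - u x0) * u x0)) =
     (v x1 - v x0) * (u x - u x0) + (u x1 - u x0) * v x0 by field.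
  (* Collinearity is stated for increasing utilities, hence the cases on the position of [u x]. *)
  have [xx0|x0x] := leP (u x) (u x0).
    have := affine_collinear ua va uvE Xx Xx0 Xx1.
    rewrite xx0 (ltW u01) => /(_ isT); lra.
  have [xx1|x1x] := leP (u x) (u x1).
    have := affine_collinear ua va uvE Xx0 Xx Xx1.
    rewrite xx1 (ltW x0x) => /(_ isT); lra.
  have := affine_collinear ua va uvE Xx0 Xx1 Xx.
  rewrite (ltW x1x) (ltW u01) => /(_ isT); lra.
(* The slope is nonnegative by monotonicity, and nonzero since [v] is not constant. *)
exists a, b; split=> //; rewrite lt_neqAle; apply/andP; split.
  have [x [y [Xx Xy]]] := vnc; apply: contra_neq => a0.
  by rewrite !vE// -a0 !mul0r.
by rewrite divr_ge0 ?subr_ge0 ?(ltW u01)//; apply: uv => //; exact: ltW.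
Qed.

End affine.

(** * Values of acts under costs and grounded sets *)

Section values.
Context d (S : algebraOfSetsType d) (R : realType).

Lemma simple_comp (T : Type) (f : S -> T) (g : T -> R) :
  simple f -> simple (g \o f).
Proof.
move=> [ff mf]; split; first by rewrite -(image_comp f g); exact: finite_image.
move=> y; rewrite comp_preimage.
(* A fiber of [g \o f] is a finite union of fibers of [f], which an algebra of sets contains. *)
have -> : f @^-1` (g @^-1` [set y]) =
    \bigcup_(x in range f `&` g @^-1` [set y]) f @^-1` [set x].
  apply/seteqP; split => [s gfs|s [x [_ gx] fx]].
    by exists (f s) => //; split => //; exists s.
  by rewrite /preimage/= fx.
apply: fin_bigcup_measurable; last by move=> x _; exact: mf.
exact: finite_setIl.
Qed.

Context (V : lmodType R) (X : set V).
Local Notation Delta := (fprob S R).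
Local Notation F := (@simple_act d S V X).
Implicit Types (u : V -> R) (f : S -> V) (x : V)
  (B C : set (Delta -> \bar R)).

Lemma simple_act_cst x : X x -> F (cst x).
Proof.
move=> Xx; split; last by move=> _ [s _ <-].
split=> [|y].
  by apply: (sub_finite_set _ (finite_set1 x)) => _ [s _ <-].
have [->|xy] := pselect (x = y).
  by have -> : (cst y : S -> V) @^-1` [set y] = setT by apply/seteqP.
by have -> : (cst x : S -> V) @^-1` [set y] = set0 by apply/seteqP; split.
Qed.

Lemma plus_values_cst u x (c : Delta -> \bar R) :
  plus_values u (cst x) c = [set ((u x)%:E + y)%E | y in range c].
Proof.
rewrite image_comp; apply: eq_imagel => p _ /=.
by rewrite [u \o _](_ : _ = cst (u x))// fint_cst.
Qed.

Lemma minus_values_cst u x (c : Delta -> \bar R) :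
  minus_values u (cst x) c = [set ((u x)%:E - y)%E | y in range c].
Proof.
rewrite image_comp; apply: eq_imagel => p _ /=.
by rewrite [u \o _](_ : _ = cst (u x))// fint_cst.
Qed.

Lemma sube0_eq (x : \bar R) (r : R) : (x - r%:E)%E = 0%E -> x = r%:E.
Proof. by move=> xr; rewrite -[LHS](subeK x (y := r%:E))// xr add0e. Qed.

(** Each cost contributes [u x] plus its own minimum, and groundedness makes the supremum of these
    minima zero. *)
Lemma maxmin_cst u C x v : grounded C -> is_maxmin u C (cst x) v ->
  v = (u x)%:E.
Proof.
move=> [_ C0] [[c Cc cv] vub]; apply: sube0_eq; apply/eqP.
rewrite eq_le -{1}C0 -C0; apply/andP; split.
  apply: ereal_sup_ubound; exists c => //.
  by apply/is_min_add; rewrite -plus_values_cst.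
apply: ge_ereal_sup => m [b Cb bm]; rewrite leeBrDr//; apply: vub.
exists b => //; rewrite plus_values_cst; apply/is_min_add.
by rewrite addeK.
Qed.

(** Each cost contributes [u x] minus its own minimum, so the least contribution corresponds to the
    supremum of the minima, which is zero. *)
Lemma minmax_cst u B x v : grounded B -> is_minmax u B (cst x) v ->
  v = (u x)%:E.
Proof.
move=> [_ B0] [[c Bc cv] vlb].
suff : ((u x)%:E - v = 0)%E.
  case: v {cv vlb} => // v [uv]; congr EFin; apply/esym/eqP.
  by rewrite -subr_eq0 uv.
apply/eqP.
rewrite eq_le -{1}B0 -B0; apply/andP; split.
  apply: ereal_sup_ubound; exists c => //.
  by apply/is_max_sub; rewrite -minus_values_cst.
apply: ge_ereal_sup => m [b Bb bm].
rewrite -[leLHS](EFin_subKe (u x)) leeD2lE// leeN2; apply: vlb.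
exists b => //; rewrite minus_values_cst; apply/is_max_sub.
by rewrite EFin_subKe.
Qed.

Lemma plus_values_min u f (c : Delta -> \bar R) : [set: Delta] !=set0 ->
  simple f -> costs c -> exists m, is_min (plus_values u f c) m.
Proof.
move=> D0 sf Cc; have [p pmin] := fint_min 1 D0 (simple_comp u sf) Cc.
exists ((fint p (u \o f))%:E + c p)%E; split; first by exists p.
by move=> _ [q _ <-]; have := pmin q; rewrite !mul1r.
Qed.

Lemma minus_values_max u f (c : Delta -> \bar R) : [set: Delta] !=set0 ->
  simple f -> costs c -> exists m, is_max (minus_values u f c) m.
Proof.
move=> D0 sf Cc; have [p pmin] := fint_min (-1) D0 (simple_comp u sf) Cc.
exists ((fint p (u \o f))%:E - c p)%E; split; first by exists p.
move=> _ [q _ <-]; have := pmin q; rewrite !mulN1r !EFinN => pq.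
by rewrite -leeN2 !oppeB ?fin_num_adde_defr.
Qed.

End values.

Arguments simple_act_cst {d S R V X x}.

(** * Certainty equivalents and optimal costs *)

Section utility.
Context d (S : algebraOfSetsType d) (R : realType) (V : lmodType R).
Variables (X : set V) (pref : (S -> V) -> (S -> V) -> Prop) (u : V -> R).
Hypotheses (X_convex : convex_set X) (niv : niveloidal X pref)
  (util : utility_index X pref u).
Local Notation F := (@simple_act d S V X).

Lemma pref_cst x y : X x -> X y -> pref (cst x) (cst y) <-> u y <= u x.
Proof.
move=> Xx Xy; have [C [gC [W [WC Wpref]]]] := util_maxmin util.
rewrite (Wpref _ _ (simple_act_cst Xx) (simple_act_cst Xy)).
by rewrite !(maxmin_cst gC (WC _ (simple_act_cst _))).
Qed.

Lemma certainty_equivalent f : F f -> exists2 x, X x & indiff pref (cst x) f.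
Proof.
move=> Ff; have [[ff _] fX] := Ff.
have Xf s : X (f s) by apply: fX; exists s.
have [C [gC [W [WC Wpref]]]] := util_maxmin util.
have Wcst x : X x -> W (cst x) = (u x)%:E.
  by move=> Xx; apply: maxmin_cst gC (WC _ (simple_act_cst Xx)).
have [s1 max1] : exists s1, forall s, u (f s) <= u (f s1).
  apply: (finite_range_max point).
  by rewrite -(image_comp f u); exact: finite_image.
have [s0 min0] : exists s0, forall s, u (f s0) <= u (f s).
  have [] := @finite_range_max R _ point (fun s => - u (f s)).
    by rewrite -(image_comp f (fun x => - u x)); exact: finite_image.
  by move=> s smax; exists s => t; rewrite -lerN2.
have : (W f <= (u (f s1))%:E)%E.
  rewrite -Wcst//; apply/Wpref => //; first exact: simple_act_cst.
  apply: (niv_monotone niv) => //; first exact: simple_act_cst.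
  by move=> s; apply/(pref_cst (Xf s1) (Xf s)).
have : ((u (f s0))%:E <= W f)%E.
  rewrite -Wcst//; apply/Wpref => //; first exact: simple_act_cst.
  apply: (niv_monotone niv) => //; first exact: simple_act_cst.
  by move=> s; apply/(pref_cst (Xf s) (Xf s0)).
(* The two bounds exclude infinite values of [W f]. *)
case Wf : (W f) => [w| |]//; rewrite ?leeNy_eq ?leye_eq// !lee_fin => w0 w1.
have [|x Xx xw] := @affine_ivt _ _ _ X_convex u (f s0) (f s1) w
  (util_affine util) (Xf _) (Xf _); first by rewrite w0 w1.
exists x => //; have Fx : F (cst x) := simple_act_cst Xx.
by split; apply/Wpref => //; rewrite Wcst// xw Wf.
Qed.

Lemma Cstar_attains f x : F f -> X x -> indiff pref (cst x) f ->
  exists2 c, Cstar X pref u c & is_min (plus_values u f c) (u x)%:E.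
Proof.
move=> Ff Xx xf; have [C [gC [W [WC Wpref]]]] := util_maxmin util.
have Wce g z : F g -> X z -> indiff pref (cst z) g -> W g = (u z)%:E.
  move=> Fg Xz [zg gz]; have Fz : F (cst z) := simple_act_cst Xz.
  rewrite -(maxmin_cst gC (WC _ Fz)); apply/eqP; rewrite eq_le.
  by apply/andP; split; apply/Wpref.
have [[c Cc cmin] _] := WC f Ff; exists c; last by rewrite -(Wce f).
have D0 : [set: fprob S R] !=set0 by case: cmin => -[p _ _] _; exists p.
have cost_c := gC.1 _ Cc; split=> // g z Fg Xz zg.
have [m mmin] := plus_values_min u D0 Fg.1 cost_c.
(* At another act the same [c] only competes for the maximum, so its minimum is at most [W g]. *)
exists m; split=> //; rewrite -(Wce g)//; apply: (WC g Fg).2.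
by exists c.
Qed.

(** The witness is optimal at [f] in a minmax representation; at any other act its maximum is at
    least the minimum over [B]. *)
Lemma Bstar_attains f x : F f -> X x -> indiff pref (cst x) f ->
  exists2 b, Bstar X pref u b & is_max (minus_values u f b) (u x)%:E.
Proof.
move=> Ff Xx xf; have [B [gB [W [WB Wpref]]]] := util_minmax util.
have Wce g z : F g -> X z -> indiff pref (cst z) g -> W g = (u z)%:E.
  move=> Fg Xz [zg gz]; have Fz : F (cst z) := simple_act_cst Xz.
  rewrite -(minmax_cst gB (WB _ Fz)); apply/eqP; rewrite eq_le.
  by apply/andP; split; apply/Wpref.
have [[b Bb bmax] _] := WB f Ff; exists b; last by rewrite -(Wce f).
have D0 : [set: fprob S R] !=set0 by case: bmax => -[p _ _] _; exists p.
have cost_b := gB.1 _ Bb; split=> // g z Fg Xz zg.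
have [m mmax] := minus_values_max u D0 Fg.1 cost_b.
exists m; split=> //; rewrite -(Wce g)//; apply: (WB g Fg).2.
by exists b.
Qed.

End utility.

(** * Positive affine transformations of utilities *)

Section cardinal.
Context (R : realType) (V : lmodType R) (X : set V).
Implicit Types u v : V -> R.

Lemma cardinally_equivalent_refl u : cardinally_equivalent X u u.
Proof. by exists 1, 0; split=> // x _; rewrite mul1r addr0. Qed.

Lemma cardinally_equivalent_sym u v :
  cardinally_equivalent X u v -> cardinally_equivalent X v u.
Proof.
move=> [a [b [a0 uv]]]; exists a^-1, (- (b / a)).
rewrite invr_gt0; split=> // x Xx.
by rewrite uv//; field; rewrite gt_eqF.
Qed.

Lemma cardinally_equivalent_le u v x y : cardinally_equivalent X u v ->
  X x -> X y -> (u x <= u y) = (v x <= v y).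
Proof.
by move=> [a [b [a0 uv]]] Xx Xy; rewrite !uv// lerD2r ler_pM2l.
Qed.

End cardinal.

Theorem proposition6p2 (R : realType) (d : measure_display)
    (S : algebraOfSetsType d) (V : lmodType R) (X : set V)
    (X_nonempty : X !=set0) (X_convex : convex_set X)
    (pref1 pref2 : (S -> V) -> (S -> V) -> Prop)
    (niv1 : niveloidal X pref1) (niv2 : niveloidal X pref2)
    (u1 u2 : V -> R)
    (util1 : utility_index X pref1 u1) (util2 : utility_index X pref2 u2) :
  [<-> more_ambiguity_averse X pref1 pref2 ;
       cardinally_equivalent X u1 u2 /\
         (forall u, common_normalization X u1 u2 u ->
            Cstar X pref1 u `<=` Cstar X pref2 u) ;
       cardinally_equivalent X u1 u2 /\
         (forall u, common_normalization X u1 u2 u ->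
            Bstar X pref2 u `<=` Bstar X pref1 u)].
Proof.
have F_cst x : X x -> simple_act X (cst x : S -> V) := simple_act_cst.
have trans1 := niv_trans niv1; have trans2 := niv_trans niv2.
(* On constant acts, comparative aversion makes [u1] weakly increasing in [u2]. *)
have averse_equiv : more_ambiguity_averse X pref1 pref2 ->
    cardinally_equivalent X u1 u2.
  move=> averse; apply: (affine_cardinally_equivalent X_convex).
  - exact: util_affine util2.
  - exact: util_affine util1.
  - exact: util_nonconstant util2.
  - exact: util_nonconstant util1.
  - move=> x y Xx Xy xy; apply/(pref_cst util1) => //.
    by apply: averse => //; [exact: F_cst|apply/(pref_cst util2)].
(* [cst y] is weakly preferred to [f] by the second preference, hence by the first, for which [f] is
   indifferent to [cst x]. *)
have averse_ce u f x y : more_ambiguity_averse X pref1 pref2 ->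
    cardinally_equivalent X u u1 -> simple_act X f -> X x -> X y ->
    indiff pref1 (cst x) f -> indiff pref2 (cst y) f -> u x <= u y.
  move=> averse uu1 Ff Xx Xy [_ fx] [yf _].
  rewrite (cardinally_equivalent_le uu1)//; apply/(pref_cst util1) => //.
  by apply: (trans1 _ f) => //; [exact: F_cst|exact: F_cst|exact: averse].
(* Here [u1 y <= u1 z <= u1 x], and [cst y] is indifferent to [f] for the first preference. *)
have averseP f x y z : cardinally_equivalent X u1 u2 -> simple_act X f ->
    X x -> X y -> X z -> pref2 (cst x) f ->
    indiff pref1 (cst y) f -> indiff pref2 (cst z) f ->
    u1 y <= u1 z -> pref1 (cst x) f.
  move=> u12 Ff Xx Xy Xz xf [yf _] [_ fz] yz.
  have zx : u1 z <= u1 x.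
    rewrite (cardinally_equivalent_le u12)//; apply/(pref_cst util2) => //.
    by apply: (trans2 _ f) => //; exact: F_cst.
  apply: (trans1 _ (cst y)) => //; [exact: F_cst|exact: F_cst|].
  by apply/(pref_cst util1) => //; exact: le_trans zx.
have C_averse : cardinally_equivalent X u1 u2 /\
    (forall u, common_normalization X u1 u2 u ->
      Cstar X pref1 u `<=` Cstar X pref2 u) ->
    more_ambiguity_averse X pref1 pref2.
  move=> [u12 sub] f x Ff Xx xf.
  have [y Xy yf] := certainty_equivalent X_convex niv1 util1 Ff.
  have [z Xz zf] := certainty_equivalent X_convex niv2 util2 Ff.
  apply: (averseP f x y z) => //.
  have [c Cc cmin] := Cstar_attains util1 Ff Xy yf.
  have [|_ /(_ f z Ff Xz zf)[m [mmin]]] := sub u1 _ c Cc.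
    by split=> //; exact: cardinally_equivalent_refl.
  by rewrite (is_min_unique mmin cmin) lee_fin.
split; last split.
- move=> averse; split=> [|u [uu1 _] c [Cc cstar]]; first exact: averse_equiv.
  split=> // f y Ff Xy yf.
  have [x Xx xf] := certainty_equivalent X_convex niv1 util1 Ff.
  have [m [mmin mx]] := cstar f x Ff Xx xf; exists m; split=> //.
  by apply: (le_trans mx); rewrite lee_fin (averse_ce _ f).
(* The inclusion for [Bstar] is derived from comparative aversion itself, recovered through
   [C_averse]. *)
- move=> /C_averse averse; split=> [|u [uu1 _] b [Bb bstar]].
    exact: averse_equiv.
  split=> // f x Ff Xx xf.
  have [y Xy yf] := certainty_equivalent X_convex niv2 util2 Ff.
  have [m [mmax ym]] := bstar f y Ff Xy yf; exists m; split=> //.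
  by apply: le_trans ym; rewrite lee_fin (averse_ce _ f).
- move=> [u12 sub] f x Ff Xx xf.
  have [y Xy yf] := certainty_equivalent X_convex niv1 util1 Ff.
  have [z Xz zf] := certainty_equivalent X_convex niv2 util2 Ff.
  apply: (averseP f x y z) => //.
  have [b Bb bmax] := Bstar_attains util2 Ff Xz zf.
  (* The normalization is [u2], since the optimal [b] comes from the second preference; cardinal
     equivalence carries the inequality back to [u1]. *)
  have [|_ /(_ f y Ff Xy yf)[m [mmax]]] := sub u2 _ b Bb.
    by split; [exact: cardinally_equivalent_sym|
               exact: cardinally_equivalent_refl].
  rewrite (is_max_unique mmax bmax) lee_fin.
  by rewrite (cardinally_equivalent_le u12).
Qed.
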